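(* Let $p\ge 1$ be an integer and let $f\in C^{p+7}$, $f:\mathbb{R}\times\mathbb{R}\to\mathbb{R}$, $(x,\alpha)\mapsto f(x,\alpha)$, satisfy the pitchfork conditions $f(0,\alpha)=0$ for all sufficiently small $|\alpha|$, $f_x(0,0)=0$, $f_{xx}(0,0)=0$, $f_{xxx}(0,0)\ne0$, $f_{x\alpha}(0,0)\neq 0$. Let $\Phi(h,\cdot,\alpha)$ be the time-$h$ map of the flow of $\dot x=f(x,\alpha)$, and let $\varphi(h,x,\alpha)$ be a sufficiently smooth one-step discretization map of order $p$ with step-size $h$, i.e. $|\Phi(h,x,\alpha)-\varphi(h,x,\alpha)|\le C h^{p+1}$ for all sufficiently small $h\ge 0$, $|x|$, $|\alpha|$ with some constant $C$, such that $\varphi(h,0,\alpha)=0$ for all sufficiently small $h\ge 0$ and $|\alpha|$, and $\varphi_x(h,0,0)=1$, $\varphi_{xx}(h,0,0)=0$ for all sufficiently small $h\ge0$. Let $\mathcal{N}_\Phi$ and $\mathcal{N}_\varphi$ be the normal forms of $\Phi$ and $\varphi$ and let $J$ be the conjugacy between them constructed as described in the context. Then there is a constant $const>0$, independent of $h$, $x$ and $\alpha$, such that for all $0<h\le h_0$, $|x|\le \varepsilon_0$ and $|\alpha|\le\alpha_0$ $$|x-J(h,x,\alpha)|\le const\cdot h^p .$$ This estimate is optimal in $h$, in the sense that in general the exponent $p$ cannot be improved: there exist maps $\mathcal{N}_\Phi,\mathcal{N}_\varphi$ of the normal form type described in the context (satisfying $|\mathcal{N}_\Phi-\mathcal{N}_\varphi|\le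 c\,h^{p+1}x^4$) such that for every sufficiently small $\alpha>0$ there is a constant $const(\alpha)>0$ with $\sup_{|x|\le\varepsilon_0}|x-J(h,x,\alpha)|\ge const(\alpha)\cdot h^p$ for all sufficiently small $h>0$.
   Context: **Normal forms.** Under the hypotheses on $f$ and $\varphi$, there are smooth invertible coordinate and parameter changes (those for $\Phi$ and those for $\varphi$ being $\mathcal{O}(h^p)$-close to each other) transforming $x\mapsto\Phi(h,x,\alpha)$ and $x\mapsto\varphi(h,x,\alpha)$, after a final parameter shift that is $\mathcal{O}(h^p)$-close to the identity and aligns the bifurcation parameters, into $$\mathcal{N}_\Phi(h,x,\alpha)=(1+h\alpha)x+s\,hx^3+hx^4\eta_4(h,x,\alpha),\qquad \mathcal{N}_\varphi(h,x,\alpha)=(1+h\alpha)x+s\,hx^3+hx^4\widetilde\eta_4(h,x,\alpha),$$ with $s\in\{1,-1\}$ the same for both and $\eta_4,\widetilde\eta_4$ smooth ($C^k$ with $k$ large enough and bounded derivatives). The new coordinate and the new parameter are again denoted by $x$ and $\alpha$. The value $s=-1$ is chosen. There is $c>0$ with $$|\mathcal{N}_\Phi(h,x,\alpha)-\mathcal{N}_\varphi(h,x,\alpha)|\le c\,h^{p+1}x^4$$ for all small $h>0$, $|x|$, $|\alpha|$. Let $K>0$ be a uniform bound for $|\partial_x^i\eta|$ ($i=0,1,2$) and $|\partial_\alpha\eta|$, $\eta\in\{\eta_4,\widetilde\eta_4\}$. Put $h_0=\min(\frac1{10},8K^2)$, $\varepsilon_0=\min(\frac1{10},\frac1{5K})$,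 $\alpha_0=\min(\frac1{288},\frac1{72K^2})$, suitably decreased further (keeping $\sqrt{2\alpha_0}<\varepsilon_0$) if $\eta_4,\widetilde\eta_4$ are only defined, or the estimate $|\mathcal{N}_\Phi(h,x,\alpha)-\mathcal{N}_\varphi(h,x,\alpha)|\le c\,h^{p+1}x^4$ only holds, on a smaller set. **Notation.** For fixed $h\in(0,h_0]$, $\alpha\in[-\alpha_0,\alpha_0]$ write $N_\Phi=\mathcal{N}_\Phi(h,\cdot,\alpha)$, $N_\varphi=\mathcal{N}_\varphi(h,\cdot,\alpha)$, $J=J(h,\cdot,\alpha)$; $g^{[k]}$ is the $k$-th iterate of $g$ ($g^{[-1]}$ the inverse). $N_\Phi,N_\varphi$ are strictly increasing and fix $0$ (attracting for $\alpha\le0$, repelling for $\alpha>0$). For $\alpha>0$ each has exactly two further fixed points near $0$, both attracting, denoted $\omega_{\Phi,-}<0<\omega_{\Phi,+}$ and $\omega_{\varphi,-}<0<\omega_{\varphi,+}$. **Construction of $J$ for $x\le 0$** (it satisfies $J\circ N_\varphi=N_\Phi\circ J$). *Inner region*, $0<\alpha\le\alpha_0$, $x\in[\omega_{\varphi,-},0]$: let $x_0=-\sqrt{\alpha/8}$, $x_{n+1}=N_\varphi(x_n)$, $y_n=N_\varphi^{[-n]}(x_0)$ ($n\ge0$), $y_{-1}=x_1$. Then $x_n\downarrow\omega_{\varphi,-}$ and $y_n\uparrow0$. Set $J(x_0)=x_0$, $J(x_1)=N_\Phi(x_0)$, $J$ linear on $[x_1,x_0]$; recursively $J=N_\Phi\circ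 J\circ N_\varphi^{[-1]}$ on $[x_{n+1},x_n]$ ($n\ge1$) and $J=N_\Phi^{[-1]}\circ J\circ N_\varphi$ on $[y_n,y_{n+1}]$ ($n\ge0$); $J(\omega_{\varphi,-})=\omega_{\Phi,-}$, $J(0)=0$. *Outer region*: let $z_0=-\varepsilon_0$, $z_n=N_\varphi^{[n]}(z_0)$; then $z_n$ increases to $\omega_{\varphi,-}$ if $\alpha>0$ and to $0$ if $\alpha\le0$. Set $J(z_0)=z_0$, $J(z_1)=N_\Phi(z_0)$, $J$ linear on $[z_0,z_1]$, and recursively $J=N_\Phi\circ J\circ N_\varphi^{[-1]}$ on $[z_n,z_{n+1}]$ ($n\ge1$); for $\alpha\le 0$ also $J(0)=0$. **Construction of $J$ for $x>0$** is analogous (mirror image): starting values $x_0=y_0=\sqrt{\alpha/8}$ in the inner region $[0,\omega_{\varphi,+}]$ (for $\alpha>0$) and $z_0=\varepsilon_0$ in the outer region, with the same iterations, the same recursions on the corresponding fundamental intervals, and $J(\omega_{\varphi,+})=\omega_{\Phi,+}$. *)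

(* Defs.v *)
From Stdlib Require Import Reals ClassicalEpsilon.
From Coquelicot Require Import Coquelicot.

Open Scope R_scope.

(** * Smoothness *)

(** C^k on the open set [U]: all iterated directional derivatives up to order
    [k] exist and are continuous on [U].  In finite dimension this is the usual
    notion. *)
Fixpoint Ck {V : NormedModule R_AbsRing} (k : nat) (U : V -> Prop) (g : V -> R)
  : Prop :=
  (forall z, U z -> continuous g z) /\
  match k with
  | O => True
  | S k' => forall v : V,
      (forall z, U z -> ex_derive (fun t : R => g (plus z (scal t v))) 0) /\
      Ck k' U (fun z => Derive (fun t : R => g (plus z (scal t v))) 0)
  end.

(** C^k on an arbitrary set [D]: [g] agrees on [D] with a C^k function defined
    on an open neighbourhood of [D].  This covers the one-sided smoothness at
    [h = 0].  On a compact [D], all derivatives up to order [k] are bounded. *)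
Definition Ck_on {V : NormedModule R_AbsRing} (k : nat) (D : V -> Prop)
  (g : V -> R) : Prop :=
  exists (U : V -> Prop) (g' : V -> R),
    open U /\ (forall z, D z -> U z) /\ Ck k U g' /\
    (forall z, D z -> g z = g' z).

Definition uncurry2 (g : R -> R -> R) (z : R * R) : R := g (fst z) (snd z).

Definition uncurry3 (g : R -> R -> R -> R) (z : R * R * R) : R :=
  g (fst (fst z)) (snd (fst z)) (snd z).

Definition box2 (H A : R) (z : R * R) : Prop :=
  0 <= fst z <= H /\ Rabs (snd z) <= A.

Definition box3 (H X A : R) (z : R * R * R) : Prop :=
  0 <= fst (fst z) <= H /\ Rabs (snd (fst z)) <= X /\ Rabs (snd z) <= A.

(** "for all sufficiently small h >= 0, |alpha|", resp.
    "for all sufficiently small h >= 0, |x|, |alpha|" *)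
Definition small2 (P : R -> R -> Prop) : Prop :=
  exists d, 0 < d /\
    forall h a, 0 <= h <= d -> Rabs a <= d -> P h a.

Definition small3 (P : R -> R -> R -> Prop) : Prop :=
  exists d, 0 < d /\
    forall h x a, 0 <= h <= d -> Rabs x <= d -> Rabs a <= d -> P h x a.

Definition Ck_small2 (k : nat) (g : R -> R -> R) : Prop :=
  exists d, 0 < d /\ Ck_on k (box2 d d) (uncurry2 g).

Definition Ck_small3 (k : nat) (g : R -> R -> R -> R) : Prop :=
  exists d, 0 < d /\ Ck_on k (box3 d d d) (uncurry3 g).

(** * The vector field, its flow and the discretization *)

Definition pitchfork (f : R -> R -> R) : Prop :=
  (exists d, 0 < d /\ forall a, Rabs a <= d -> f 0 a = 0) /\
  Derive (fun x => f x 0) 0 = 0 /\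
  Derive_n (fun x => f x 0) 2 0 = 0 /\
  Derive_n (fun x => f x 0) 3 0 <> 0 /\
  Derive (fun a => Derive (fun x => f x a) 0) 0 <> 0.

(** [Phi] is the (local) time-[h] map of x' = f (x, alpha). *)
Definition time_map (f : R -> R -> R) (Phi : R -> R -> R -> R) : Prop :=
  exists d, 0 < d /\
    forall h x a, Rabs h < d -> Rabs x < d -> Rabs a < d ->
      Phi 0 x a = x /\ is_derive (fun t => Phi t x a) h (f (Phi h x a) a).

Definition order_p (p : nat) (Phi phi : R -> R -> R -> R) : Prop :=
  exists C, small3 (fun h x a =>
    Rabs (Phi h x a - phi h x a) <= C * h ^ (p + 1)).

Definition pitchfork_map (phi : R -> R -> R -> R) : Prop :=
  small2 (fun h a => phi h 0 a = 0) /\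
  exists d, 0 < d /\ forall h, 0 <= h <= d ->
    is_derive (fun x => phi h x 0) 0 1 /\
    is_derive_n (fun x => phi h x 0) 2 0 0.

(** * Normal forms *)

(** The case s = -1. *)
Definition normal_form (eta : R -> R -> R -> R) (h x a : R) : R :=
  (1 + h * a) * x + (-1) * h * x ^ 3 + h * x ^ 4 * eta h x a.

(** New coordinate [chi h x a] as a function of the old coordinate [x] and the
    old parameter [a]. *)
Definition coordinate_change (k : nat) (chi : R -> R -> R -> R) : Prop :=
  Ck_small3 k chi /\
  small2 (fun h a => chi h 0 a = 0) /\
  exists psi, Ck_small3 k psi /\
    small3 (fun h x a => psi h (chi h x a) a = x /\ chi h (psi h x a) a = x).

Definition parameter_change (k : nat) (b : R -> R -> R) : Prop :=
  Ck_small2 k b /\ b 0 0 = 0 /\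
  exists b', Ck_small2 k b' /\
    small2 (fun h a => b' h (b h a) = a /\ b h (b' h a) = a).

(** [sigma] is the final parameter shift. *)
Definition normal_forms_of (p k : nat) (Phi phi NPhi Nphi : R -> R -> R -> R)
  : Prop :=
  exists (chiPhi chiphi : R -> R -> R -> R) (bPhi bphi sigma : R -> R -> R),
    coordinate_change k chiPhi /\ coordinate_change k chiphi /\
    parameter_change k bPhi /\ parameter_change k bphi /\
    parameter_change k sigma /\
    (exists C,
       small3 (fun h x a => Rabs (chiPhi h x a - chiphi h x a) <= C * h ^ p) /\
       small2 (fun h a => Rabs (bPhi h a - bphi h a) <= C * h ^ p) /\
       small2 (fun h a => Rabs (sigma h a - a) <= C * h ^ p)) /\
    small2 (fun h _ => sigma h (bphi h 0) = bPhi h 0) /\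
    small3 (fun h x a =>
      chiPhi h (Phi h x a) a = NPhi h (chiPhi h x a) (bPhi h a) /\
      chiphi h (phi h x a) a = Nphi h (chiphi h x a) (sigma h (bphi h a))).

Definition eta_bound (H X A K : R) (eta : R -> R -> R -> R) : Prop :=
  forall h x a, 0 <= h <= H -> Rabs x < X -> Rabs a < A ->
    (forall i, (i <= 2)%nat -> Rabs (Derive_n (fun t => eta h t a) i x) <= K) /\
    Rabs (Derive (fun t => eta h x t) a) <= K.

(** The remainders [etaPhi], [etaphi] are defined for 0 <= h <= H, |x| <= X,
    |alpha| <= A, where also the estimate on the difference holds. *)
Definition normal_form_pair (p k : nat) (H X A K c : R)
  (etaPhi etaphi : R -> R -> R -> R) : Prop :=
  0 < H /\ 0 < X /\ 0 < A /\ 0 < K /\ 0 < c /\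
  Ck_on k (box3 H X A) (uncurry3 etaPhi) /\
  Ck_on k (box3 H X A) (uncurry3 etaphi) /\
  eta_bound H X A K etaPhi /\ eta_bound H X A K etaphi /\
  (forall h x a, 0 < h <= H -> Rabs x <= X -> Rabs a <= A ->
     Rabs (normal_form etaPhi h x a - normal_form etaphi h x a)
       <= c * h ^ (p + 1) * x ^ 4).

(** The inequalities (instead of equalities) leave room for the decrease that
    the domain [H], [X], [A] may require. *)
Definition admissible (H X A K h0 eps0 alpha0 : R) : Prop :=
  (0 < h0 <= Rmin (1 / 10) (8 * K ^ 2) /\ h0 <= H) /\
  (0 < eps0 <= Rmin (1 / 10) (1 / (5 * K)) /\ eps0 < X) /\
  (0 < alpha0 <= Rmin (1 / 288) (1 / (72 * K ^ 2)) /\ alpha0 < A) /\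
  sqrt (2 * alpha0) < eps0.

(** * The conjugacy

    Below, [F] = N_Phi (h, ., alpha), [G] = N_phi (h, ., alpha), and [s] = -1 or
    1 is the sign of [x], so that both halves of the construction, which are
    mirror images, are treated at once. *)

Definition local_inverse (eps : R) (g : R -> R) (y : R) : R :=
  epsilon (inhabits 0) (fun x => Rabs x <= eps /\ g x = y).

(** For alpha > 0, the unique nonzero fixed point of [g] on the side [s]. *)
Definition omega (eps : R) (g : R -> R) (s : R) : R :=
  epsilon (inhabits 0) (fun w => 0 < s * w <= eps /\ g w = w).

Definition orbit (g : R -> R) (x0 : R) (n : nat) : R := Nat.iter n g x0.

(** An [n] such that [x] lies between [u n] and [u (S n)]. *)
Definition locate (u : nat -> R) (x : R) : nat :=
  epsilon (inhabits O)
    (fun n => Rmin (u n) (u (S n)) <= x <= Rmax (u n) (u (S n))).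

(** J on the initial fundamental interval between [x0] and [G x0]: the affine
    function with x0 |-> x0 and G x0 |-> F x0. *)
Definition J_start (F G : R -> R) (x0 x : R) : R :=
  x0 + (F x0 - x0) / (G x0 - x0) * (x - x0).

(** J on the interval between G^[n] x0 and G^[n+1] x0. *)
Fixpoint J_forward (eps : R) (F G : R -> R) (x0 : R) (n : nat) (x : R) : R :=
  match n with
  | O => J_start F G x0 x
  | S m => F (J_forward eps F G x0 m (local_inverse eps G x))
  end.

(** J on the interval between y_(n-1) and y_n, where y_n = G^[-n] x0 and
    y_(-1) = G x0. *)
Fixpoint J_backward (eps : R) (F G : R -> R) (x0 : R) (n : nat) (x : R) : R :=
  match n with
  | O => J_start F G x0 x
  | S m => local_inverse eps F (J_backward eps F G x0 m (G x))
  end.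

Definition J_inner (eps : R) (F G : R -> R) (a s x : R) : R :=
  let x0 := s * sqrt (a / 8) in
  if Rle_dec (Rabs x0) (Rabs x)
  then J_forward eps F G x0 (locate (orbit G x0) x) x
  else J_backward eps F G x0
         (S (locate (orbit (local_inverse eps G) x0) x)) x.

Definition J_outer (eps : R) (F G : R -> R) (s x : R) : R :=
  let z0 := s * eps in
  J_forward eps F G z0 (locate (orbit G z0) x) x.

Definition J_fiber (eps : R) (F G : R -> R) (a x : R) : R :=
  let s := if Rlt_dec x 0 then -1 else 1 in
  if Req_dec_T x 0 then 0
  else if Rlt_dec 0 a then
    let w := omega eps G s in
    if Req_dec_T x w then omega eps F s
    else if Rlt_dec (Rabs x) (Rabs w) then J_inner eps F G a s x
    else J_outer eps F G s x
  else J_outer eps F G s x.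

Definition conjugacy (eps0 : R) (NPhi Nphi : R -> R -> R -> R) (h x a : R) : R :=
  J_fiber eps0 (fun t => NPhi h t a) (fun t => Nphi h t a) a x.

(* Main.v *)
Require Import Defs.
From Stdlib Require Import Reals.
From Coquelicot Require Import Coquelicot.
From Stdlib Require Import Psatz ClassicalEpsilon Classical FunctionalExtensionality.
Open Scope R_scope.

(** Fix [h] and [a], and write F for the normal form of the flow, G for that of
    the discretization.  On either half-line such a map has, after reflection,
    the form x + h x (a - q x) with a profile [q] comparable to x^2, and the
    profiles of F and G differ by at most D x^3 with D = c h^p.  The constant c
    itself bounds |x - J x| / h^p.

    The map J sends G^n (u) to F^n (v), where [u] lies in an initial fundamental
    interval and [v] is its affine image.  A step of the iteration adds the
    defect h D x^4, and the number of steps grows like 1/h and is unbounded near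
    the fixed points; the errors must therefore be damped.

    - In forward direction, that is in the outer region and between
      sqrt (a / 8) and the nonzero fixed point, the relative error is the right
      measure.  As F x / x decreases in [x], with a gap of order h x^2 for a
      relative change of x, the inequality |v - u| <= D u is preserved by
      passing from (u, v) to (G u, F v) ([near_step]).  This single invariant
      covers a > 0 and a <= 0, including the slow convergence to 0 at a = 0.

    - In backward direction, between 0 and sqrt (a / 8), the origin repels.  F
      expands there by 1 + h a / 2, and the inequality |v - u| <= D a is
      preserved by the inverse steps ([backward_step]).

    - The nonzero fixed points are compared directly from the equations
      q w' = a = r w ([fixed_point_near]).

    Neither invariant requires D to be small, so the bound holds for all
    admissible step-sizes at once.

    For the optimality take the remainders 0 and h^p.  The nonzero fixed points
    then solve w'^2 = a and w^2 - h^p w^3 = a; they are at least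
    (a / 2) h^p apart, and J maps one to the other ([power_remainder_gap]). *)

(** * Half maps: a normal form restricted to one half-line *)

(** The bounds say that [q] grows like the square, up to the factors 2/3 and
    4/3.  They replace all derivative bounds on the remainder in the dynamical
    part of the argument, and they are invariant under reflection of the
    line. *)
Definition profile (eps : R) (q : R -> R) : Prop :=
  q 0 = 0 /\
  forall u x, 0 <= u <= x -> x <= eps ->
    2 / 3 * (x ^ 2 - u ^ 2) <= q x - q u <= 4 / 3 * (x ^ 2 - u ^ 2).

(** The normal form x + h x (a - q x), with q x = x^2 up to higher order. *)
Definition half_map (h a : R) (q : R -> R) (x : R) : R :=
  x * (1 + h * a - h * q x).

(** The last inequality places the nonzero fixed point, where [q] equals [a],
    strictly inside [0, eps]. *)
Definition small_parameters (h a eps : R) : Prop :=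
  0 < h <= 1 / 10 /\ -1 / 288 <= a <= 1 / 288 /\ 0 < eps <= 1 / 10 /\
  2 * a < eps ^ 2.

Lemma profile_bounds eps q x :
  profile eps q -> 0 <= x <= eps -> 2 / 3 * x ^ 2 <= q x <= 4 / 3 * x ^ 2.
Proof.
  intros [H0 Hq] Hx. specialize (Hq 0 x). rewrite H0 in Hq. lra.
Qed.

Lemma profile_le eps q u x :
  profile eps q -> 0 <= u <= x -> x <= eps -> q u <= q x.
Proof.
  intros [_ Hq] Hu Hx. specialize (Hq u x Hu Hx). nra.
Qed.

Lemma profile_lt eps q u x :
  profile eps q -> 0 <= u < x -> x <= eps -> q u < q x.
Proof.
  intros [_ Hq] Hu Hx. assert (0 <= u <= x) by lra.
  specialize (Hq u x H Hx). nra.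
Qed.

Lemma half_map_0 h a q : half_map h a q 0 = 0.
Proof. unfold half_map. ring. Qed.

(** The upper bound holds because [q] is increasing, so subtracting h x q(x)
    only brings points together.  The lower bound gives monotonicity near 0
    and, close to 0 for [a > 0], the expansion that drives the backward part of
    the construction. *)
Lemma half_map_expansion h a eps q u x :
  small_parameters h a eps -> profile eps q -> 0 <= u <= x -> x <= eps ->
  (x - u) * (1 + h * a - 4 * h * x ^ 2) <= half_map h a q x - half_map h a q u
    <= (x - u) * (1 + h * a).
Proof.
  intros (Hh & Ha & He & Hae) Hq Hu Hx.
  assert (Hb := profile_bounds eps q u Hq ltac:(lra)).
  destruct Hq as [_ Hq]. specialize (Hq u x Hu Hx).
  unfold half_map.
  replace (x * (1 + h * a - h * q x) - u * (1 + h * a - h * q u))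
    with ((x - u) * (1 + h * a) - h * (x * (q x - q u) + (x - u) * q u)) by ring.
  assert (B1 : 0 <= x * (q x - q u) <= x * (4 / 3 * (x ^ 2 - u ^ 2))).
  { assert (0 <= x ^ 2 - u ^ 2) by nra. split.
    - apply Rmult_le_pos; lra.
    - apply Rmult_le_compat_l; lra. }
  assert (B2 : 0 <= (x - u) * q u <= (x - u) * (4 / 3 * u ^ 2)).
  { split.
    - apply Rmult_le_pos; nra.
    - apply Rmult_le_compat_l; lra. }
  assert (B3 : (x - u) * (x ^ 2 + x * u + u ^ 2) <= (x - u) * (3 * x ^ 2)).
  { apply Rmult_le_compat_l; [lra | nra]. }
  assert (B4 : x * (q x - q u) + (x - u) * q u <= (x - u) * (4 * x ^ 2)) by nra.
  split; nra.
Qed.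

Lemma half_map_le h a eps q u x :
  small_parameters h a eps -> profile eps q -> 0 <= u <= x -> x <= eps ->
  half_map h a q u <= half_map h a q x.
Proof.
  intros Hs Hq Hu Hx.
  destruct (half_map_expansion h a eps q u x Hs Hq Hu Hx) as [E _].
  destruct Hs as (Hh & Ha & He & Hae).
  assert (0 <= 1 + h * a - 4 * h * x ^ 2).
  { assert (x ^ 2 <= 1 / 100) by nra. nra. }
  nra.
Qed.

Lemma half_map_lt h a eps q u x :
  small_parameters h a eps -> profile eps q -> 0 <= u < x -> x <= eps ->
  half_map h a q u < half_map h a q x.
Proof.
  intros Hs Hq Hu Hx.
  destruct (half_map_expansion h a eps q u x Hs Hq ltac:(lra) Hx) as [E _].
  destruct Hs as (Hh & Ha & He & Hae).
  assert (0 < 1 + h * a - 4 * h * x ^ 2).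
  { assert (x ^ 2 <= 1 / 100) by nra. nra. }
  nra.
Qed.

Lemma half_map_le_inv h a eps q u x :
  small_parameters h a eps -> profile eps q ->
  0 <= u <= eps -> 0 <= x <= eps ->
  half_map h a q u <= half_map h a q x -> u <= x.
Proof.
  intros Hs Hq Hu Hx H. destruct (Rle_lt_dec u x) as [|L]; [assumption|].
  assert (L' := half_map_lt h a eps q x u Hs Hq ltac:(lra) ltac:(lra)). lra.
Qed.

Lemma half_map_inj h a eps q u x :
  small_parameters h a eps -> profile eps q ->
  0 <= u <= eps -> 0 <= x <= eps ->
  half_map h a q u = half_map h a q x -> u = x.
Proof.
  intros Hs Hq Hu Hx H. apply Rle_antisym;
    apply (half_map_le_inv h a eps q); auto; lra.
Qed.

Lemma half_map_range h a eps q x :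
  small_parameters h a eps -> profile eps q -> 0 <= x <= eps ->
  x / 2 <= half_map h a q x <= eps.
Proof.
  intros Hs Hq Hx. split.
  - destruct (half_map_expansion h a eps q 0 x Hs Hq ltac:(lra) ltac:(lra)) as [E _].
    rewrite half_map_0 in E. destruct Hs as (Hh & Ha & He & Hae).
    assert (1 / 2 <= 1 + h * a - 4 * h * x ^ 2).
    { assert (x ^ 2 <= 1 / 100) by nra. nra. }
    nra.
  - assert (L := half_map_le h a eps q x eps Hs Hq ltac:(lra) ltac:(lra)).
    assert (B := profile_bounds eps q eps Hq ltac:(lra)).
    unfold half_map in L at 2. destruct Hs as (Hh & Ha & He & Hae).
    assert (a <= q eps) by nra. assert (h * a <= h * q eps) by nra. nra.
Qed.

(** An intermediate value theorem for a function controlled on [x1, x2] only: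
    composing with the projection of the line onto the interval makes the
    function continuous everywhere. *)
Lemma lipschitz_ivt f L x1 x2 y :
  x1 <= x2 ->
  (forall u x, x1 <= u <= x -> x <= x2 -> Rabs (f x - f u) <= L * (x - u)) ->
  f x1 <= y <= f x2 -> exists t, x1 <= t <= x2 /\ f t = y.
Proof.
  intros H12 HL Hy.
  set (cl := fun t => Rmax x1 (Rmin t x2)).
  assert (Hcl : forall t, x1 <= cl t <= x2).
  { intro t. unfold cl, Rmax, Rmin. repeat destruct Rle_dec; lra. }
  assert (Hcid : forall t, x1 <= t <= x2 -> cl t = t).
  { intros t Ht. unfold cl, Rmax, Rmin. repeat destruct Rle_dec; lra. }
  assert (Hcl1 : forall s t, Rabs (cl t - cl s) <= Rabs (t - s)).
  { intros s t. unfold cl, Rmax, Rmin, Rabs.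
    repeat destruct Rle_dec; repeat destruct Rcase_abs; lra. }
  assert (HL' : forall u x, x1 <= u <= x2 -> x1 <= x <= x2 ->
            Rabs (f x - f u) <= (Rabs L) * Rabs (x - u)).
  { intros u x Hu Hx. assert (LA := Rle_abs L).
    destruct (Rle_dec u x).
    - specialize (HL u x ltac:(lra) ltac:(lra)).
      rewrite (Rabs_pos_eq (x - u)) by lra. nra.
    - specialize (HL x u ltac:(lra) ltac:(lra)).
      rewrite Rabs_minus_sym, (Rabs_minus_sym x u), (Rabs_pos_eq (u - x)) by lra.
      nra. }
  assert (C : continuity (fun t => f (cl t) - y)).
  { intros t e He.
    assert (P : 0 < Rabs L + 1) by (assert (P := Rabs_pos L); lra).
    (* Adding 1 covers the case L = 0. *)
    exists (e / (Rabs L + 1)). split.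
    - apply Rdiv_lt_0_compat; lra.
    - intros x [_ Hx]. simpl in *. unfold Rdist in *.
      replace (f (cl x) - y - (f (cl t) - y)) with (f (cl x) - f (cl t)) by ring.
      apply (Rle_lt_trans _ ((Rabs L) * Rabs (x - t))).
      + eapply Rle_trans; [apply HL'; apply Hcl|].
        apply Rmult_le_compat_l; [apply Rabs_pos | apply Hcl1].
      + apply (Rmult_lt_compat_r (Rabs L + 1)) in Hx; [|lra].
        unfold Rdiv in Hx. rewrite Rmult_assoc, Rinv_l in Hx by lra.
        assert (Q := Rabs_pos (x - t)). nra. }
  destruct (IVT_cor (fun t => f (cl t) - y) x1 x2 C H12) as [t [Ht E]].
  - rewrite !Hcid by lra. nra.
  - exists t. rewrite Hcid in E by assumption. split; [assumption | lra].
Qed.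

Lemma half_map_onto h a eps q x1 x2 y :
  small_parameters h a eps -> profile eps q -> 0 <= x1 <= x2 -> x2 <= eps ->
  half_map h a q x1 <= y <= half_map h a q x2 ->
  exists t, x1 <= t <= x2 /\ half_map h a q t = y.
Proof.
  intros Hs Hq H1 H2. apply (lipschitz_ivt _ 2); [lra|].
  intros u x Hu Hx.
  assert (E := half_map_expansion h a eps q u x Hs Hq ltac:(lra) ltac:(lra)).
  assert (L := half_map_le h a eps q u x Hs Hq ltac:(lra) ltac:(lra)).
  rewrite Rabs_pos_eq by lra. destruct Hs as (Hh & Ha & He & Hae).
  assert (h * a <= 1) by nra. nra.
Qed.

Lemma half_map_fixed_point h a eps q :
  small_parameters h a eps -> profile eps q -> 0 < a ->
  exists w, 0 < w <= eps /\ q w = a.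
Proof.
  intros (Hh & Ha & He & Hae) Hq Ha0.
  assert (B := profile_bounds eps q eps Hq ltac:(lra)).
  destruct (lipschitz_ivt q (4 / 3 * (2 * eps)) 0 eps a) as [w [Hw E]].
  - lra.
  - intros u x Hu Hx. assert (L := profile_le eps q u x Hq ltac:(lra) ltac:(lra)).
    destruct Hq as [_ Hq]. specialize (Hq u x ltac:(lra) ltac:(lra)).
    rewrite Rabs_pos_eq by lra.
    assert ((x - u) * (x + u) <= (x - u) * (2 * eps)).
    { apply Rmult_le_compat_l; lra. }
    nra.
  - destruct Hq as [Hq0 _]. rewrite Hq0. nra.
  - exists w. split; [|assumption]. split; [|lra].
    destruct (Req_dec w 0) as [W|W]; [|lra].
    destruct Hq as [Hq0 _]. subst w. lra.
Qed.

(** * Comparing two half maps *)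

(** A difference of at most c h^(p+1) x^4 between two half maps is a
    difference of at most c h^p x^3 between their profiles, because a half map
    contains [q] with the factor h x. *)
Definition close (eps D : R) (q r : R -> R) : Prop :=
  forall x, 0 <= x <= eps -> Rabs (q x - r x) <= D * x ^ 3.

(** The error is measured relative to [u].  This is the quantity that the
    iteration does not increase: x |-> M(x) / x is decreasing for a half map
    [M], so relative distances shrink. *)
Definition near (eps D u v : R) : Prop :=
  0 <= u <= eps /\ 0 <= v <= eps /\ Rabs (v - u) <= D * u.

(** Put y = (1 + D) u - v, the room left by [v].  If y = 0, then
    q v - r u >= 0, since the growth of [q] from [u] to [v] outweighs
    D u^3.  In general q v - r u >= - u^2 y, and the loss of order
    h y is paid for by the term y itself.  No smallness of [D] enters, so the
    estimate is uniform up to the largest step-size. *)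
Lemma near_upper h a eps D q r u v :
  small_parameters h a eps -> profile eps q -> profile eps r ->
  close eps D q r -> 0 <= u <= v -> v <= eps -> v <= (1 + D) * u ->
  half_map h a q v <= (1 + D) * half_map h a r u.
Proof.
  intros (Hh & Ha & He & Hae) [_ Hq] Hr Hc Hu Hv HD.
  assert (Br := profile_bounds eps r u Hr ltac:(lra)).
  specialize (Hq u v Hu Hv).
  specialize (Hc u ltac:(lra)). apply Rabs_le_between in Hc.
  set (y := (1 + D) * u - v).
  assert (Hy : 0 <= y) by (unfold y; lra).
  assert (Eu : D * u ^ 3 = u ^ 2 * (y + (v - u))) by (unfold y; ring).
  assert (Hu2 : 0 <= u ^ 2 <= 1 / 100) by nra.
  assert (Q : - (u ^ 2 * y) <= q v - r u).
  { assert ((v - u) * u ^ 2 <= (v - u) * (2 / 3 * (v + u))).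
    { apply Rmult_le_compat_l; nra. }
    nra. }
  unfold half_map. rewrite <- Rmult_assoc.
  replace ((1 + D) * u) with (y + v) by (unfold y; ring).
  assert (A1 : 0 <= v * (q v - r u + u ^ 2 * y)) by (apply Rmult_le_pos; lra).
  assert (A2 : 0 <= h * (v * (q v - r u + u ^ 2 * y))) by (apply Rmult_le_pos; lra).
  (* The claim is the sum of A2 and y times A3. *)
  assert (A3 : 0 <= 1 + h * a - h * r u - h * (v * u ^ 2)).
  { assert (0 <= v * u ^ 2 <= 1) by nra. nra. }
  assert (A4 := Rmult_le_pos _ _ Hy A3). nra.
Qed.

Lemma near_lower h a eps D q r u :
  small_parameters h a eps -> profile eps q -> close eps D q r -> 0 <= D <= 1 ->
  0 <= u <= eps ->
  (1 - D) * half_map h a r u <= half_map h a q ((1 - D) * u).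
Proof.
  intros (Hh & Ha & He & Hae) [_ Hq] Hc HD Hu.
  assert (0 <= (1 - D) * u <= u) by nra.
  specialize (Hq ((1 - D) * u) u ltac:(lra) ltac:(lra)).
  specialize (Hc u ltac:(lra)). apply Rabs_le_between in Hc.
  unfold half_map.
  assert (0 <= D * u ^ 2) by nra.
  assert (D * u ^ 3 <= 1 / 10 * (D * u ^ 2)) by nra.
  assert (q ((1 - D) * u) <= r u).
  { assert (D * (D * u ^ 2) <= D * u ^ 2) by nra. nra. }
  rewrite <- Rmult_assoc.
  apply Rmult_le_compat_l; nra.
Qed.

(** Hence a relative error of at most [D] survives every forward step, whether
    the orbit decreases, increases or converges to 0.  If [D > 1] the lower
    bound is void, as half maps are nonnegative. *)
Lemma near_step h a eps D q r u v :
  small_parameters h a eps -> profile eps q -> profile eps r ->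
  close eps D q r -> 0 <= D -> near eps D u v ->
  near eps D (half_map h a r u) (half_map h a q v).
Proof.
  intros Hs Hq Hr Hc HD (Hu & Hv & Huv).
  apply Rabs_le_between in Huv.
  assert (Ru := half_map_range h a eps r u Hs Hr Hu).
  assert (Rv := half_map_range h a eps q v Hs Hq Hv).
  split; [lra|]. split; [lra|]. apply Rabs_le_between. split.
  - destruct (Rle_dec D 1) as [D1|D1]; [|nra].
    assert (L := near_lower h a eps D q r u Hs Hq Hc ltac:(lra) Hu).
    assert (M := half_map_le h a eps q ((1 - D) * u) v Hs Hq ltac:(nra) ltac:(lra)).
    lra.
  - destruct (Rle_lt_dec u v) as [E|E].
    + assert (L := near_upper h a eps D q r u v Hs Hq Hr Hc ltac:(lra)
                     ltac:(lra) ltac:(lra)). lra.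
    + assert (L := near_upper h a eps D q r u u Hs Hq Hr Hc ltac:(lra)
                     ltac:(lra) ltac:(nra)).
      assert (M := half_map_le h a eps q v u Hs Hq ltac:(lra) ltac:(lra)). lra.
Qed.

(** Fundamental intervals are run through downwards in the outer region and
    upwards in the inner one, hence the two orders. *)
Definition between (b c x : R) : Prop := b <= x <= c \/ c <= x <= b.

Lemma half_map_difference h a eps D q r x :
  small_parameters h a eps -> close eps D q r -> 0 <= x <= eps ->
  Rabs (half_map h a q x - half_map h a r x) <= h * (D * x ^ 4).
Proof.
  intros (Hh & _) Hc Hx. specialize (Hc x Hx). unfold half_map.
  replace (x * (1 + h * a - h * q x) - x * (1 + h * a - h * r x))
    with (- (h * x) * (q x - r x)) by ring.
  rewrite Rabs_mult, Rabs_Ropp, (Rabs_pos_eq (h * x)) by nra.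
  replace (h * (D * x ^ 4)) with (h * x * (D * x ^ 3)) by ring.
  apply Rmult_le_compat_l; nra.
Qed.

(** As q w' = r w, the values q w' and q w differ by at most the cubic term
    D w^3, and a relative displacement of [w] changes [q] by a multiple of
    w^2. *)
Lemma fixed_point_near a eps D q r w w' :
  profile eps q -> profile eps r -> close eps D q r -> 0 <= D -> eps <= 1 / 10 ->
  0 < w <= eps -> 0 < w' <= eps -> q w' = a -> r w = a ->
  Rabs (w' - w) <= D * w.
Proof.
  intros [_ Hq] _ Hc HD He Hw Hw' E E'.
  specialize (Hc w ltac:(lra)). rewrite E' in Hc. apply Rabs_le_between in Hc.
  assert (D * w ^ 3 = w ^ 2 * (D * w)) by ring.
  assert (0 <= D * w) by nra.
  apply Rabs_le_between.
  destruct (Rle_lt_dec w w') as [L|L].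
  - specialize (Hq w w' ltac:(lra) ltac:(lra)). rewrite E in Hq.
    assert (w * (w' - w) <= w * (D * w)); [|nra].
    assert (w * (w' - w) <= 1 / 2 * (w' ^ 2 - w ^ 2)) by nra.
    assert (w * (w * (D * w)) <= 1 / 10 * (w * (D * w))).
    { apply Rmult_le_compat_r; nra. }
    nra.
  - specialize (Hq w' w ltac:(lra) ltac:(lra)). rewrite E in Hq.
    assert (w * (w - w') <= w * (2 * (D * w * w))); [|nra].
    assert (w * (w - w') <= w ^ 2 - w' ^ 2) by nra.
    nra.
Qed.

(** The affine start map moves a point by a fraction of the distance between
    the two images of [x0]. *)
Lemma J_start_estimate h a eps D q r x0 u :
  small_parameters h a eps -> close eps D q r -> 0 <= x0 <= eps ->
  half_map h a r x0 <> x0 -> between x0 (half_map h a r x0) u ->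
  between x0 (half_map h a q x0)
    (J_start (half_map h a q) (half_map h a r) x0 u) /\
  Rabs (J_start (half_map h a q) (half_map h a r) x0 u - u)
    <= h * (D * x0 ^ 4).
Proof.
  intros Hs Hc Hx0 Hne Hu.
  assert (Hd := half_map_difference h a eps D q r x0 Hs Hc Hx0).
  unfold J_start, between in *.
  set (y := half_map h a q x0) in *. set (z := half_map h a r x0) in *.
  set (th := (u - x0) / (z - x0)).
  assert (Eu : u = x0 + th * (z - x0)) by (unfold th; field; lra).
  assert (Hth : 0 <= th <= 1).
  { destruct (Rlt_dec x0 z) as [L|L].
    - assert (0 <= u - x0 <= z - x0) by lra. nra.
    - assert (0 <= x0 - u <= x0 - z) by lra. nra. }
  replace (x0 + (y - x0) / (z - x0) * (u - x0)) with (x0 + th * (y - x0))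
    by (unfold th; field; lra).
  clearbody th. split.
  - destruct (Rle_dec x0 y); [left | right]; nra.
  - rewrite Eu. replace (x0 + th * (y - x0) - (x0 + th * (z - x0)))
      with (th * (y - z)) by ring.
    rewrite Rabs_mult, Rabs_pos_eq by lra.
    assert (P := Rabs_pos (y - z)). nra.
Qed.

(** On [0, x0] with x0 = sqrt (a / 8) the repelling fixed point 0 dominates:
    both maps expand by at least 1 + h a / 2, so inverse steps contract.  The
    gain D a * (h a / 2) exceeds the new defect h D u^4 <= h D (a / 8)^2.  The
    bound [v <= x0] comes from monotonicity and keeps the two points in the
    region of expansion. *)
Lemma backward_step h a eps D q r x0 u v' :
  small_parameters h a eps -> profile eps q -> profile eps r ->
  close eps D q r -> 0 <= D -> 0 < x0 <= eps -> 8 * x0 ^ 2 = a ->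
  0 <= u <= x0 -> 0 <= v' <= half_map h a q x0 ->
  Rabs (v' - half_map h a r u) <= D * a ->
  exists v, 0 <= v <= x0 /\ half_map h a q v = v' /\ Rabs (v - u) <= D * a.
Proof.
  intros Hs Hq Hr Hc HD Hx Hxa Hu Hv' Hd.
  destruct (half_map_onto h a eps q 0 x0 v' Hs Hq ltac:(lra) ltac:(lra))
    as [v [Hv E]].
  { rewrite half_map_0. assumption. }
  exists v. split; [assumption|]. split; [assumption|]. subst v'.
  assert (Dd := half_map_difference h a eps D q r u Hs Hc ltac:(lra)).
  assert (X : forall y z, 0 <= y <= z -> z <= x0 ->
    (z - y) * (1 + h * a / 2) <= half_map h a q z - half_map h a q y).
  { intros y z Hy Hz.
    destruct (half_map_expansion h a eps q y z Hs Hq Hy ltac:(lra)) as [L _].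
    eapply Rle_trans; [|exact L].
    apply Rmult_le_compat_l; [lra|].
    destruct Hs as (Hh & _). assert (z ^ 2 <= x0 ^ 2) by nra. nra. }
  destruct Hs as (Hh & Ha & He & Hae).
  assert (B : h * (D * u ^ 4) <= D * a * (h * a / 2)).
  { assert (u ^ 2 <= a / 8) by nra.
    assert (u ^ 4 <= a / 8 * (a / 8)).
    { replace (u ^ 4) with (u ^ 2 * u ^ 2) by ring.
      apply Rmult_le_compat; nra. }
    replace (D * a * (h * a / 2)) with (h * (D * (a * a / 2))) by field.
    apply Rmult_le_compat_l; [lra|]. apply Rmult_le_compat_l; nra. }
  apply Rabs_le_between in Dd. apply Rabs_le_between in Hd.
  assert (0 < 1 + h * a / 2) by nra.
  apply Rabs_le_between.
  destruct (Rle_dec u v) as [L|L].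
  - specialize (X u v ltac:(lra) ltac:(lra)).
    assert (v - u <= D * a); [|nra].
    apply (Rmult_le_reg_r (1 + h * a / 2)); [assumption|]. lra.
  - specialize (X v u ltac:(lra) ltac:(lra)).
    assert (u - v <= D * a); [|nra].
    apply (Rmult_le_reg_r (1 + h * a / 2)); [assumption|]. lra.
Qed.

(** * Transfer to the two sides of the line *)
Definition side (s : R) : Prop := s = 1 \/ s = -1.

Lemma Rabs_side s t : side s -> 0 <= t -> Rabs (s * t) = t.
Proof.
  intros [-> | ->] Ht; unfold Rabs; destruct Rcase_abs; lra.
Qed.

(** After the substitution x = s t, a normal form becomes a half map on
    t >= 0, so that the two mirror images of the construction reduce to
    one. *)
Definition sided (h a eps s : R) (q g : R -> R) : Prop :=
  forall t, 0 <= t <= eps -> g (s * t) = s * half_map h a q t.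

Definition inj_on (eps : R) (g : R -> R) : Prop :=
  forall x y, Rabs x <= eps -> Rabs y <= eps -> g x = g y -> x = y.

(** Here [F] and [G] are the two normal forms for fixed [h] and [a], and [q] and
    [r] are their profiles on the side [s].  Injectivity is required on both
    sides of 0, because the local inverses are chosen in the whole interval
    [-eps, eps]. *)
Definition side_pair (h a eps D s : R) (q r F G : R -> R) : Prop :=
  small_parameters h a eps /\ 0 <= D /\ side s /\
  profile eps q /\ profile eps r /\ close eps D q r /\
  sided h a eps s q F /\ sided h a eps s r G /\ inj_on eps F /\ inj_on eps G.

Lemma inj_on_two_sides h a eps q q' g :
  small_parameters h a eps -> profile eps q -> profile eps q' ->
  sided h a eps 1 q g -> sided h a eps (-1) q' g -> inj_on eps g.
Proof.
  intros Hs Hq Hq' Hp Hm x y Hx Hy E.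
  apply Rabs_le_between in Hx. apply Rabs_le_between in Hy.
  assert (P : forall t, 0 <= t <= eps -> g t = half_map h a q t).
  { intros t Ht. rewrite <- (Rmult_1_l t) at 1. rewrite Hp by assumption. ring. }
  assert (N : forall t, - eps <= t <= 0 -> g t = - half_map h a q' (- t)).
  { intros t Ht. replace t with (-1 * - t) at 1 by ring. rewrite Hm by lra. ring. }
  assert (C : forall u v, 0 <= u <= eps -> - eps <= v <= 0 -> g u = g v -> u = v).
  { intros u v Hu Hv Euv. rewrite P, N in Euv by lra.
    assert (Ru := half_map_range h a eps q u Hs Hq Hu).
    assert (Rv := half_map_range h a eps q' (- v) Hs Hq' ltac:(lra)). lra. }
  destruct (Rle_dec 0 x) as [X|X]; destruct (Rle_dec 0 y) as [Y|Y].
  - rewrite !P in E by lra.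
    apply (half_map_inj h a eps q); auto; lra.
  - apply C; auto; lra.
  - symmetry. apply C; auto; lra.
  - rewrite !N in E by lra.
    assert (- x = - y); [|lra].
    apply (half_map_inj h a eps q'); auto; lra.
Qed.

Lemma local_inverse_sided h a eps s q g t :
  side s -> sided h a eps s q g -> inj_on eps g -> 0 <= t <= eps ->
  local_inverse eps g (s * half_map h a q t) = s * t.
Proof.
  intros Hs Hg Hi Ht. unfold local_inverse.
  destruct (epsilon_spec (inhabits 0)
    (fun x => Rabs x <= eps /\ g x = s * half_map h a q t)) as [B E].
  - exists (s * t). rewrite Rabs_side by (assumption || lra). split; [lra | apply Hg; lra].
  - apply Hi; [assumption | rewrite Rabs_side by (assumption || lra); lra |].
    rewrite E. symmetry. apply Hg. lra.
Qed.

Lemma omega_sided h a eps s q g w :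
  small_parameters h a eps -> side s -> profile eps q -> sided h a eps s q g ->
  0 < w <= eps -> q w = a -> omega eps g s = s * w.
Proof.
  intros (Hh & _) Hs Hq Hg Hw E. unfold omega.
  assert (S2 : s * s = 1) by (destruct Hs as [-> | ->]; ring).
  destruct (epsilon_spec (inhabits 0) (fun v => 0 < s * v <= eps /\ g v = v))
    as [B F].
  - exists (s * w). split.
    + rewrite <- Rmult_assoc, S2. lra.
    + rewrite Hg by lra. unfold half_map. rewrite E. f_equal. ring.
  - set (v := epsilon _ _) in *. clearbody v.
    assert (Ev : v = s * (s * v)) by (rewrite <- Rmult_assoc, S2; ring).
    rewrite Ev. f_equal. set (t := s * v) in *. clearbody t.
    rewrite Ev, Hg in F by lra.
    assert (F' : half_map h a q t = t).
    { apply (Rmult_eq_reg_l s); [assumption | nra]. }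
    unfold half_map in F'.
    assert (Q : q t = a).
    { assert (Z : t * h * (a - q t) = 0) by lra.
      apply Rmult_integral in Z. destruct Z as [Z|Z]; [|lra].
      apply Rmult_integral in Z. lra. }
    destruct (Rtotal_order t w) as [L|[L|L]]; [|assumption|].
    + assert (X := profile_lt eps q t w Hq ltac:(lra) ltac:(lra)). lra.
    + assert (X := profile_lt eps q w t Hq ltac:(lra) ltac:(lra)). lra.
Qed.

Lemma orbit_range h a eps q x0 n :
  small_parameters h a eps -> profile eps q -> 0 < x0 <= eps ->
  0 < orbit (half_map h a q) x0 n <= eps.
Proof.
  intros Hs Hq Hx. induction n as [|n IH]; [exact Hx|].
  change (0 < half_map h a q (orbit (half_map h a q) x0 n) <= eps).
  assert (X := half_map_range h a eps q _ Hs Hq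
    (conj (Rlt_le _ _ (proj1 IH)) (proj2 IH))). lra.
Qed.

Lemma orbit_sided h a eps s q g x0 n :
  small_parameters h a eps -> profile eps q -> sided h a eps s q g ->
  0 < x0 <= eps -> orbit g (s * x0) n = s * orbit (half_map h a q) x0 n.
Proof.
  intros Hs Hq Hg Hx. induction n as [|n IH]; [reflexivity|].
  change (g (orbit g (s * x0) n)
    = s * half_map h a q (orbit (half_map h a q) x0 n)).
  rewrite IH. apply Hg.
  assert (X := orbit_range h a eps q x0 n Hs Hq Hx). lra.
Qed.

Lemma J_start_sided h a eps s q r F G x0 u :
  side s -> sided h a eps s q F -> sided h a eps s r G -> 0 <= x0 <= eps ->
  J_start F G (s * x0) (s * u)
    = s * J_start (half_map h a q) (half_map h a r) x0 u.
Proof.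
  intros Hs HF HG Hx. unfold J_start. rewrite HF, HG by assumption.
  replace (s * half_map h a r x0 - s * x0) with (s * (half_map h a r x0 - x0)) by ring.
  unfold Rdiv. rewrite Rinv_mult.
  destruct Hs as [-> | ->].
  - rewrite Rinv_1. ring.
  - replace (/ -1) with (-1) by field. ring.
Qed.

(** Induction along the orbit: each further fundamental interval costs one
    forward step, which [near_step] absorbs. *)
Lemma J_forward_sided h a eps D s q r F G x0 n u :
  side_pair h a eps D s q r F G -> 0 < x0 <= eps -> half_map h a r x0 <> x0 ->
  between (orbit (half_map h a r) x0 n) (orbit (half_map h a r) x0 (S n)) u ->
  exists v, J_forward eps F G (s * x0) n (s * u) = s * v /\ near eps D u v.
Proof.
  intros (Hs & HD & Hsd & Hq & Hr & Hc & HF & HG & _ & HiG) Hx Hne.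
  assert (Rx := half_map_range h a eps r x0 Hs Hr ltac:(lra)).
  assert (Rx' := half_map_range h a eps q x0 Hs Hq ltac:(lra)).
  revert u. induction n as [|n IH]; intros u Hu.
  - simpl in Hu |- *.
    rewrite (J_start_sided h a eps s q r) by (auto; lra).
    destruct (J_start_estimate h a eps D q r x0 u Hs Hc ltac:(lra) Hne Hu) as [B E].
    eexists. split; [reflexivity|].
    unfold between in *. split; [lra|]. split; [lra|].
    eapply Rle_trans; [exact E|].
    assert (x0 / 2 <= u) by lra.
    destruct Hs as (Hh & Ha & He & _).
    assert (x0 ^ 3 <= 1) by (assert (x0 ^ 2 <= 1) by nra; nra).
    assert (h * x0 ^ 4 <= u) by (assert (x0 ^ 4 <= x0) by nra; nra).
    replace (h * (D * x0 ^ 4)) with (D * (h * x0 ^ 4)) by ring.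
    apply Rmult_le_compat_l; lra.
  - assert (On := orbit_range h a eps r x0 n Hs Hr Hx).
    assert (OSn := orbit_range h a eps r x0 (S n) Hs Hr Hx).
    assert (T : exists t, between (orbit (half_map h a r) x0 n)
                  (orbit (half_map h a r) x0 (S n)) t /\ half_map h a r t = u).
    { destruct (Rle_dec (orbit (half_map h a r) x0 n)
                  (orbit (half_map h a r) x0 (S n))) as [L|L].
      - assert (M := half_map_le h a eps r _ _ Hs Hr
           (conj (Rlt_le _ _ (proj1 On)) L) (proj2 OSn)).
        destruct (half_map_onto h a eps r (orbit (half_map h a r) x0 n)
           (orbit (half_map h a r) x0 (S n)) u Hs Hr ltac:(lra) ltac:(lra))
          as [t [Ht E]].
        + change (orbit (half_map h a r) x0 (S n) <= u
             <= orbit (half_map h a r) x0 (S (S n))).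
          change (orbit (half_map h a r) x0 (S n) <=
                  orbit (half_map h a r) x0 (S (S n))) in M.
          destruct Hu; lra.
        + exists t. split; [left; assumption | assumption].
      - assert (M := half_map_le h a eps r (orbit (half_map h a r) x0 (S n))
           (orbit (half_map h a r) x0 n) Hs Hr ltac:(lra) ltac:(lra)).
        destruct (half_map_onto h a eps r (orbit (half_map h a r) x0 (S n))
           (orbit (half_map h a r) x0 n) u Hs Hr ltac:(lra) ltac:(lra))
          as [t [Ht E]].
        + change (orbit (half_map h a r) x0 (S (S n)) <= u
             <= orbit (half_map h a r) x0 (S n)).
          change (orbit (half_map h a r) x0 (S (S n)) <=
                  orbit (half_map h a r) x0 (S n)) in M.
          destruct Hu; lra.
        + exists t. split; [right; assumption | assumption]. }
    destruct T as [t [Ht E]]. subst u.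
    assert (Rt : 0 <= t <= eps) by (destruct Ht; lra).
    cbn [J_forward]. rewrite (local_inverse_sided h a eps s r G) by auto.
    destruct (IH t Ht) as [v [Ev Nv]]. rewrite Ev.
    exists (half_map h a q v). split; [apply HF, Nv|].
    apply (near_step h a eps D q r); auto.
Qed.

(** * Locating a point in a fundamental interval *)

(** The fundamental intervals of an orbit reach every point before the limit of
    the orbit, since until [x] is passed the steps have a length bounded
    below. *)
Lemma descending_crossing (o : nat -> R) x d :
  0 < d -> x <= o O -> (forall n, x <= o n -> o (S n) <= o n - d) ->
  exists n, o (S n) <= x <= o n.
Proof.
  intros Hd H0 Hstep. apply NNPP. intro Hno.
  assert (Hall : forall n, x <= o n /\ o n <= o O - INR n * d).
  { induction n as [|n [IH1 IH2]].
    - simpl. lra.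
    - assert (N : x < o (S n)).
      { apply Rnot_le_lt. intro L. apply Hno. exists n. lra. }
      specialize (Hstep n IH1). rewrite S_INR. lra. }
  destruct (INR_unbounded ((o O - x) / d)) as [n Hn].
  destruct (Hall n) as [H1 H2].
  apply (Rmult_lt_compat_r d) in Hn; [|assumption].
  unfold Rdiv in Hn. rewrite Rmult_assoc, Rinv_l in Hn by lra. lra.
Qed.

Lemma ascending_crossing (o : nat -> R) x d :
  0 < d -> o O <= x -> (forall n, o n <= x -> o n + d <= o (S n)) ->
  exists n, o n <= x <= o (S n).
Proof.
  intros Hd H0 Hstep.
  destruct (descending_crossing (fun n => - o n) (- x) d) as [n Hn]; auto.
  - lra.
  - intros n Hn. specialize (Hstep n ltac:(lra)). lra.
  - exists n. lra.
Qed.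

Lemma locate_sided s (w o : nat -> R) u :
  side s -> (forall n, w n = s * o n) ->
  (exists n, between (o n) (o (S n)) u) ->
  between (o (locate w (s * u))) (o (S (locate w (s * u)))) u.
Proof.
  intros Hs Hw [n Hn].
  assert (Eq : forall m, Rmin (w m) (w (S m)) <= s * u <= Rmax (w m) (w (S m))
                <-> between (o m) (o (S m)) u).
  { intro m. rewrite !Hw. unfold between, Rmin, Rmax.
    destruct Hs as [-> | ->]; repeat destruct Rle_dec; split; intro; lra. }
  apply Eq. unfold locate. apply epsilon_spec. exists n. apply Eq, Hn.
Qed.

(** * The three regions of the conjugacy *)

(** The condition [a < r u] says that [u] lies outside the nonzero fixed point,
    or that there is no such fixed point. *)
Lemma J_outer_sided h a eps D s q r F G u :
  side_pair h a eps D s q r F G -> 0 < u <= eps -> a < r u ->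
  exists v, J_outer eps F G s (s * u) = s * v /\ near eps D u v.
Proof.
  intros HP Hu Hau.
  assert (HP' := HP).
  destruct HP' as (Hs & HD & Hsd & Hq & Hr & Hc & HF & HG & _ & HiG).
  unfold J_outer. assert (Hs' := Hs). destruct Hs' as (Hh & Ha & He & Hae).
  apply (J_forward_sided h a eps D s q r); [exact HP | lra | | ].
  - assert (B := profile_bounds eps r eps Hr ltac:(lra)).
    unfold half_map. assert (a < r eps) by nra. 
    assert (0 < eps * (h * (r eps - a))).
    { apply Rmult_lt_0_compat; [lra|]. apply Rmult_lt_0_compat; lra. }
    lra.
  - apply (locate_sided s); [assumption | |].
    + intro n. apply (orbit_sided h a eps); auto; lra.
    + (* At or above [u] a step has length at least u h (r u - a). *)
      destruct (descending_crossing (orbit (half_map h a r) eps) u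
                 (u * (h * (r u - a)))) as [n Hn].
      * apply Rmult_lt_0_compat; [lra|]. apply Rmult_lt_0_compat; lra.
      * simpl. lra.
      * intros n Hn. assert (On := orbit_range h a eps r eps n Hs Hr ltac:(lra)).
        change (orbit (half_map h a r) eps (S n))
          with (half_map h a r (orbit (half_map h a r) eps n)).
        set (t := orbit (half_map h a r) eps n) in *. clearbody t.
        assert (L := profile_le eps r u t Hr ltac:(lra) ltac:(lra)).
        unfold half_map.
        assert (u * (h * (r u - a)) <= t * (h * (r t - a))); [|lra].
        apply Rmult_le_compat; try lra.
        -- apply Rmult_le_pos; lra.
        -- apply Rmult_le_compat_l; lra.
      * exists n. right. exact Hn.
Qed.

(** The backward orbit stays in (0, x0], where preimages exist by the
    intermediate value theorem. *)
Lemma backward_orbit_sided h a eps s r G x0 :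
  small_parameters h a eps -> side s -> profile eps r -> sided h a eps s r G ->
  inj_on eps G -> 0 < x0 <= eps -> x0 <= half_map h a r x0 ->
  exists y : nat -> R, y O = x0 /\ forall n, 0 < y n <= x0 /\
    half_map h a r (y (S n)) = y n /\
    orbit (local_inverse eps G) (s * x0) n = s * y n.
Proof.
  intros Hs Hsd Hr HG Hi Hx HM.
  assert (S2 : s * s = 1) by (destruct Hsd as [-> | ->]; ring).
  set (y := fun n => s * orbit (local_inverse eps G) (s * x0) n).
  assert (E : forall n, orbit (local_inverse eps G) (s * x0) n = s * y n).
  { intro n. unfold y. rewrite <- Rmult_assoc, S2. ring. }
  assert (Y0 : y O = x0).
  { unfold y. simpl. rewrite <- Rmult_assoc, S2. ring. }
  assert (St : forall n, 0 < y n <= x0 ->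
             0 < y (S n) <= x0 /\ half_map h a r (y (S n)) = y n).
  { intros n Hn.
    destruct (half_map_onto h a eps r 0 x0 (y n) Hs Hr ltac:(lra) ltac:(lra))
      as [t [Ht Et]].
    { rewrite half_map_0. lra. }
    assert (Yt : y (S n) = t).
    { unfold y.
      change (s * local_inverse eps G (orbit (local_inverse eps G) (s * x0) n) = t).
      rewrite E, <- Et, (local_inverse_sided h a eps s r G) by (auto; lra).
      rewrite <- Rmult_assoc, S2. ring. }
    rewrite Yt. split; [|assumption].
    destruct (Req_dec t 0) as [Z|Z]; [|lra].
    rewrite Z, half_map_0 in Et. lra. }
  assert (Rg : forall n, 0 < y n <= x0).
  { induction n as [|n IH]; [lra | apply (St n IH)]. }
  exists y. split; [assumption|]. intro n. split; [apply Rg|].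
  split; [apply (St n (Rg n)) | apply E].
Qed.

(** Induction along the backward orbit, [backward_step] at each step.  The first
    preimage carries [x0, G x0], where the map is affine, into [0, x0]. *)
Lemma J_backward_sided h a eps D s q r F G x0 (y : nat -> R) n u :
  side_pair h a eps D s q r F G -> 0 < x0 <= eps -> 8 * x0 ^ 2 = a ->
  y O = x0 ->
  (forall n, 0 < y n <= x0 /\ half_map h a r (y (S n)) = y n) ->
  y (S n) <= u <= y n ->
  exists v, J_backward eps F G (s * x0) (S n) (s * u) = s * v /\
    0 <= v <= x0 /\ Rabs (v - u) <= D * a.
Proof.
  intros (Hs & HD & Hsd & Hq & Hr & Hc & HF & HG & HiF & HiG) Hx Hxa Hy0 Hy.
  assert (Grow : forall g, profile eps g -> x0 < half_map h a g x0).
  { intros g Hg. assert (B := profile_bounds eps g x0 Hg ltac:(lra)).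
    unfold half_map. destruct Hs as (Hh & _).
    assert (0 < x0 * (h * (a - g x0))); [|lra].
    apply Rmult_lt_0_compat; [lra|]. apply Rmult_lt_0_compat; nra. }
  assert (Gq := Grow q Hq). assert (Gr := Grow r Hr).
  revert u. induction n as [|n IH]; intros u Hu.
  - assert (Y1 := Hy 1%nat). assert (Y0 := Hy O). rewrite Hy0 in *.
    assert (L1 := half_map_le h a eps r (y 1%nat) u Hs Hr ltac:(lra) ltac:(lra)).
    assert (L2 := half_map_le h a eps r u x0 Hs Hr ltac:(lra) ltac:(lra)).
    destruct (J_start_estimate h a eps D q r x0 (half_map h a r u) Hs Hc
       ltac:(lra) ltac:(lra) ltac:(left; lra)) as [B E].
    set (v' := J_start (half_map h a q) (half_map h a r) x0 (half_map h a r u)) in *.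
    destruct (backward_step h a eps D q r x0 u v' Hs Hq Hr Hc HD Hx Hxa)
      as [v (Hv & Ev & Dv)]; [lra | unfold between in B; lra | |].
    + eapply Rle_trans; [exact E|].
      destruct Hs as (Hh & Ha & _).
      assert (h * x0 ^ 4 <= a).
      { replace (x0 ^ 4) with (x0 ^ 2 * x0 ^ 2) by ring.
        replace (x0 ^ 2) with (a / 8) by lra. assert (0 < a) by nra.
        assert (a / 8 * (a / 8) <= a) by nra. nra. }
      replace (h * (D * x0 ^ 4)) with (D * (h * x0 ^ 4)) by ring.
      apply Rmult_le_compat_l; lra.
    + exists v. split; [|auto]. cbn [J_backward].
      rewrite HG, (J_start_sided h a eps s q r) by (auto; lra).
      fold v'. rewrite <- Ev. apply (local_inverse_sided h a eps); auto; lra.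
  - assert (Yn := Hy n). assert (Ysn := Hy (S n)). assert (Yssn := Hy (S (S n))).
    assert (L1 := half_map_le h a eps r (y (S (S n))) u Hs Hr ltac:(lra) ltac:(lra)).
    assert (L2 := half_map_le h a eps r u (y (S n)) Hs Hr ltac:(lra) ltac:(lra)).
    destruct (IH (half_map h a r u) ltac:(lra)) as [v' (Ev' & Hv' & Dv')].
    destruct (backward_step h a eps D q r x0 u v' Hs Hq Hr Hc HD Hx Hxa)
      as [v (Hv & Ev & Dv)]; [lra | lra | assumption |].
    exists v. split; [|auto].
    change (local_inverse eps F (J_backward eps F G (s * x0) (S n) (G (s * u)))
            = s * v).
    rewrite HG by lra. rewrite Ev', <- Ev.
    apply (local_inverse_sided h a eps); auto; lra.
Qed.

Lemma J_inner_sided h a eps D s q r F G w u :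
  side_pair h a eps D s q r F G -> 0 < a -> 0 < w <= eps -> r w = a ->
  0 < u < w ->
  exists v, J_inner eps F G a s (s * u) = s * v /\ Rabs (v - u) <= D.
Proof.
  intros HP Ha0 Hw Ew Hu. assert (HP' := HP).
  destruct HP' as (Hs & HD & Hsd & Hq & Hr & Hc & HF & HG & HiF & HiG).
  assert (Hs' := Hs). destruct Hs' as (Hh & Ha & He & Hae).
  unfold J_inner. set (x0 := sqrt (a / 8)).
  assert (Hx0 : 0 < x0) by (apply sqrt_lt_R0; lra).
  assert (Hxa : 8 * x0 ^ 2 = a).
  { assert (X := sqrt_sqrt (a / 8) ltac:(lra)). fold x0 in X. nra. }
  clearbody x0.
  assert (Hxe : x0 < eps) by nra.
  assert (Bx := profile_bounds eps r x0 Hr ltac:(lra)).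
  assert (Hrx : r x0 < a) by nra.
  assert (HM : x0 < half_map h a r x0).
  { unfold half_map. assert (0 < x0 * (h * (a - r x0))); [|lra].
    apply Rmult_lt_0_compat; [lra|]. apply Rmult_lt_0_compat; lra. }
  rewrite !Rabs_side by (auto; lra).
  destruct (Rle_dec x0 u) as [L|L].
  - destruct (J_forward_sided h a eps D s q r F G x0
      (locate (orbit G (s * x0)) (s * u)) u HP ltac:(lra) ltac:(lra))
      as [v [Ev (Nu & Nv & N)]].
    + apply (locate_sided s); [assumption | |].
      * intro n. apply (orbit_sided h a eps); auto; lra.
      * assert (Lu : r u < a).
        { rewrite <- Ew. apply (profile_lt eps); auto; lra. }
        (* Between [x0] and [u] a step has length at least x0 h (a - r u). *)
        assert (Inv : forall n, x0 <= orbit (half_map h a r) x0 n /\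
          (orbit (half_map h a r) x0 n <= u ->
           orbit (half_map h a r) x0 n + x0 * (h * (a - r u)) <=
           orbit (half_map h a r) x0 (S n))).
        { assert (St : forall t, x0 <= t <= u ->
             t + x0 * (h * (a - r u)) <= half_map h a r t).
          { intros t Ht.
            assert (P := profile_le eps r t u Hr ltac:(lra) ltac:(lra)).
            unfold half_map.
            assert (x0 * (h * (a - r u)) <= t * (h * (a - r t))); [|lra].
            apply Rmult_le_compat; try lra.
            - apply Rmult_le_pos; lra.
            - apply Rmult_le_compat_l; lra. }
          induction n as [|n [IH1 IH2]].
          - split; [simpl; lra|]. intro. apply (St x0). lra.
          - assert (X : x0 <= orbit (half_map h a r) x0 (S n)).
            { assert (R := orbit_range h a eps r x0 n Hs Hr ltac:(lra)).
              assert (M := half_map_le h a eps r x0 _ Hs Hr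
                (conj (Rlt_le _ _ Hx0) IH1) (proj2 R)).
              change (x0 <= half_map h a r (orbit (half_map h a r) x0 n)). lra. }
            split; [exact X|]. intro Y. apply St. lra. }
        destruct (ascending_crossing (orbit (half_map h a r) x0) u
                    (x0 * (h * (a - r u)))) as [n Hn].
        -- apply Rmult_lt_0_compat; [lra|]. apply Rmult_lt_0_compat; lra.
        -- exact L.
        -- intros n. apply Inv.
        -- exists n. left. exact Hn.
    + exists v. split; [exact Ev|]. nra.
  - destruct (backward_orbit_sided h a eps s r G x0 Hs Hsd Hr HG HiG ltac:(lra)
                ltac:(lra)) as [y [Y0 Hy]].
    set (n := locate (orbit (local_inverse eps G) (s * x0)) (s * u)).
    (* The step from y m to y (S m) has length h t (a - r t) at t = y (S m). *)
    assert (Step : forall m, y (S m) <= y m /\ (u <= y (S m) ->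
              y (S m) <= y m - u * (h * (a - r x0)))).
    { intro m. destruct (Hy m) as (Ym & Em & _).
      destruct (Hy (S m)) as (Ysm & _ & _).
      rewrite <- Em. set (t := y (S m)) in *.
      assert (P := profile_le eps r t x0 Hr ltac:(lra) ltac:(lra)).
      unfold half_map. split.
      - assert (0 <= t * (h * (a - r t))); [|lra].
        apply Rmult_le_pos; [lra|]. apply Rmult_le_pos; lra.
      - intro Ht.
        assert (u * (h * (a - r x0)) <= t * (h * (a - r t))); [|lra].
        apply Rmult_le_compat; try lra.
        + apply Rmult_le_pos; lra.
        + apply Rmult_le_compat_l; lra. }
    assert (Hn : between (y n) (y (S n)) u).
    { apply (locate_sided s); [assumption | intro m; apply Hy |].
      apply NNPP. intro Hno.
      assert (Hall : forall m, u < y m).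
      { induction m as [|m IH]; [lra|].
        apply Rnot_le_lt. intro C. apply Hno. exists m. right. lra. }
      destruct (descending_crossing y u (u * (h * (a - r x0)))) as [m Hm].
      - apply Rmult_lt_0_compat; [lra|]. apply Rmult_lt_0_compat; lra.
      - lra.
      - intros m _. apply Step. specialize (Hall (S m)). lra.
      - specialize (Hall (S m)). lra. }
    destruct (J_backward_sided h a eps D s q r F G x0 y n u HP ltac:(lra) Hxa Y0)
      as [v (Ev & _ & Dv)].
    + intro m. split; apply Hy.
    + destruct (Step n) as [Sn _]. destruct Hn; lra.
    + exists v. split; [exact Ev|]. nra.
Qed.

Lemma J_fiber_fixed_point h a eps D s q r F G w w' :
  side_pair h a eps D s q r F G -> 0 < a -> 0 < w <= eps -> r w = a ->
  0 < w' <= eps -> q w' = a -> J_fiber eps F G a (s * w) = s * w'.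
Proof.
  intros (Hs & HD & Hsd & Hq & Hr & Hc & HF & HG & HiF & HiG) Ha Hw Ew Hw' Ew'.
  unfold J_fiber.
  replace (if Rlt_dec (s * w) 0 then -1 else 1) with s
    by (destruct Hsd as [-> | ->]; destruct Rlt_dec; lra).
  destruct Req_dec_T as [E|_]; [destruct Hsd as [-> | ->]; lra|].
  destruct Rlt_dec as [_|]; [|lra].
  rewrite (omega_sided h a eps s r G w) by assumption.
  destruct Req_dec_T as [_|E]; [|lra].
  apply (omega_sided h a eps s q); assumption.
Qed.

Lemma J_fiber_estimate h a eps D s q r F G u :
  side_pair h a eps D s q r F G -> 0 < u <= eps ->
  Rabs (s * u - J_fiber eps F G a (s * u)) <= D.
Proof.
  intros HP Hu. assert (HP' := HP).
  destruct HP' as (Hs & HD & Hsd & Hq & Hr & Hc & HF & HG & HiF & HiG).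
  assert (Hs' := Hs). destruct Hs' as (Hh & Ha & He & Hae).
  assert (Fin : forall x, (exists v, x = s * v /\ Rabs (v - u) <= D) ->
            Rabs (s * u - x) <= D).
  { intros x (v & -> & Dv). rewrite <- Rmult_minus_distr_l, Rabs_mult.
    rewrite (Rabs_minus_sym u v).
    replace (Rabs s) with 1; [lra|].
    destruct Hsd as [-> | ->]; unfold Rabs; destruct Rcase_abs; lra. }
  apply Fin.
  assert (Out : a < r u ->
    exists v, J_outer eps F G s (s * u) = s * v /\ Rabs (v - u) <= D).
  { intro L. destruct (J_outer_sided h a eps D s q r F G u HP Hu L)
      as [v [Ev (_ & _ & N)]].
    exists v. split; [exact Ev|]. nra. }
  destruct (Rlt_dec 0 a) as [A|A].
  - destruct (half_map_fixed_point h a eps r Hs Hr A) as [w [Hw Ew]].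
    destruct (Req_dec u w) as [U|U].
    + destruct (half_map_fixed_point h a eps q Hs Hq A) as [w' [Hw' Ew']].
      exists w'. subst u. split; [apply (J_fiber_fixed_point h a eps D s q r); auto|].
      assert (N := fixed_point_near a eps D q r w w' Hq Hr Hc HD ltac:(lra)
                     Hw Hw' Ew' Ew). nra.
    + unfold J_fiber.
      replace (if Rlt_dec (s * u) 0 then -1 else 1) with s
        by (destruct Hsd as [-> | ->]; destruct Rlt_dec; lra).
      destruct Req_dec_T as [E|_]; [destruct Hsd as [-> | ->]; lra|].
      destruct Rlt_dec as [_|]; [|lra].
      rewrite (omega_sided h a eps s r G w) by assumption.
      destruct Req_dec_T as [E|_]; [destruct Hsd as [-> | ->]; lra|].
      rewrite !Rabs_side by (auto; lra).
      destruct Rlt_dec as [L|L].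
      * apply (J_inner_sided h a eps D s q r F G w); auto; lra.
      * apply Out. rewrite <- Ew. apply (profile_lt eps); auto; lra.
  - unfold J_fiber.
    replace (if Rlt_dec (s * u) 0 then -1 else 1) with s
      by (destruct Hsd as [-> | ->]; destruct Rlt_dec; lra).
    destruct Req_dec_T as [E|_]; [destruct Hsd as [-> | ->]; lra|].
    destruct Rlt_dec as [|_]; [lra|].
    apply Out. assert (B := profile_bounds eps r u Hr ltac:(lra)). nra.
Qed.

(** * Normal forms and their profiles *)

Definition remainder_profile (s : R) (e : R -> R) (t : R) : R :=
  t ^ 2 - s * t ^ 3 * e (s * t).

Lemma normal_form_sided eta h a eps s :
  side s ->
  sided h a eps s (remainder_profile s (fun x => eta h x a))
    (fun x => normal_form eta h x a).
Proof.
  intros Hs t _. unfold normal_form, half_map, remainder_profile.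
  destruct Hs as [-> | ->]; ring.
Qed.

(** From [u] to [x] the remainder term changes by at most
    (x^3 - u^3) K + u^3 K (x - u), and K eps <= 1/5 makes this at most
    (3/10 + 1/50) (x^2 - u^2); the sum 3/10 + 1/50 < 1/3 is the origin of the
    factors 2/3 and 4/3 of a profile. *)
Lemma remainder_profile_spec eps K s e :
  side s -> 0 < eps <= 1 / 10 -> K * eps <= 1 / 5 ->
  (forall x, Rabs x <= eps -> Rabs (e x) <= K) ->
  (forall x y, Rabs x <= eps -> Rabs y <= eps ->
     Rabs (e x - e y) <= K * Rabs (x - y)) ->
  profile eps (remainder_profile s e).
Proof.
  intros Hs He HK Hb Hl. unfold remainder_profile. split; [ring|].
  intros u x Hu Hx.
  assert (Bx : Rabs (s * x) <= eps) by (rewrite Rabs_side by (auto; lra); lra).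
  assert (Bu : Rabs (s * u) <= eps) by (rewrite Rabs_side by (auto; lra); lra).
  assert (K0 : 0 <= K) by (eapply Rle_trans; [apply Rabs_pos | apply (Hb _ Bx)]).
  assert (L := Hl _ _ Bx Bu). rewrite <- Rmult_minus_distr_l in L.
  rewrite Rabs_side in L by (auto; lra).
  assert (B := Hb _ Bx).
  assert (E : x ^ 2 - s * x ^ 3 * e (s * x) - (u ^ 2 - s * u ^ 3 * e (s * u))
    = x ^ 2 - u ^ 2
      - s * ((x ^ 3 - u ^ 3) * e (s * x) + u ^ 3 * (e (s * x) - e (s * u)))) by ring.
  assert (C : Rabs (s * ((x ^ 3 - u ^ 3) * e (s * x)
                         + u ^ 3 * (e (s * x) - e (s * u))))
              <= 1 / 3 * (x ^ 2 - u ^ 2)).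
  { rewrite Rabs_mult. replace (Rabs s) with 1
      by (destruct Hs as [-> | ->]; unfold Rabs; destruct Rcase_abs; lra).
    rewrite Rmult_1_l. eapply Rle_trans; [apply Rabs_triang|].
    assert (P3 : x ^ 3 - u ^ 3 = (x - u) * (x ^ 2 + x * u + u ^ 2)) by ring.
    assert (P2 : x ^ 2 - u ^ 2 = (x - u) * (x + u)) by ring.
    assert (Q : 0 <= x ^ 2 + x * u + u ^ 2 <= 3 / 2 * eps * (x + u)) by nra.
    assert (U3 : 0 <= u ^ 3 <= 1 / 100 * (x + u)).
    { assert (0 <= u ^ 2 <= 1 / 100) by nra. nra. }
    rewrite !Rabs_mult, P3, P2.
    rewrite (Rabs_pos_eq ((x - u) * _)) by (apply Rmult_le_pos; lra).
    rewrite (Rabs_pos_eq (u ^ 3)) by lra.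
    apply (Rle_trans _ ((x - u) * (3 / 2 * eps * (x + u)) * K
                        + u ^ 3 * (K * (x - u)))).
    - apply Rplus_le_compat.
      + apply Rmult_le_compat; try lra.
        * apply Rmult_le_pos; lra.
        * apply Rabs_pos.
        * apply Rmult_le_compat_l; lra.
      + apply Rmult_le_compat_l; lra.
    - assert (T1 : (x - u) * (3 / 2 * eps * (x + u)) * K
                <= 3 / 10 * ((x - u) * (x + u))).
      { replace ((x - u) * (3 / 2 * eps * (x + u)) * K)
          with (3 / 2 * (K * eps) * ((x - u) * (x + u))) by ring.
        apply Rmult_le_compat_r; [|lra]. apply Rmult_le_pos; lra. }
      assert (T2 : u ^ 3 * (K * (x - u)) <= 1 / 50 * ((x - u) * (x + u))).
      { assert (K * u <= 1 / 5) by nra.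
        replace (u ^ 3 * (K * (x - u))) with (K * u * (u * u) * (x - u)) by ring.
        replace (1 / 50 * ((x - u) * (x + u))) with (1 / 50 * (x + u) * (x - u)) by ring.
        apply Rmult_le_compat_r; [lra|].
        assert (K * u * (u * u) <= 1 / 5 * (u * u)) by (apply Rmult_le_compat_r; nra).
        nra. }
      nra. }
  rewrite E. apply Rabs_le_between in C. lra.
Qed.

(** For |x| < X the line through (h, x, a) in the direction of [x] remains in
    the box for a while, so the smooth extension may be replaced by [eta]. *)
Lemma Ck_on_box3_ex_derive k H X A eta h x a :
  (1 <= k)%nat -> Ck_on k (box3 H X A) (uncurry3 eta) ->
  0 <= h <= H -> Rabs x < X -> Rabs a <= A ->
  ex_derive (fun t => eta h t a) x.
Proof.
  intros Hk (U & g & _ & HU & HC & Hg) Hh Hx Ha.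
  destruct k as [|k]; [lia|]. destruct HC as [_ HC].
  set (z := (h, x, a) : R * R * R). set (v := (0, 1, 0) : R * R * R).
  destruct (HC v) as [Hd _].
  assert (Uz : U z).
  { apply HU. unfold box3; simpl. lra. }
  specialize (Hd z Uz). destruct Hd as [l Hl].
  exists (scal 1 l).
  apply (is_derive_ext_loc (fun t => g (plus z (scal (t - x) v)))).
  - assert (Hd : 0 < X - Rabs x) by lra.
    exists (mkposreal _ Hd). intros t Ht.
    unfold ball in Ht; simpl in Ht; unfold AbsRing_ball, abs, minus, plus, opp in Ht;
      simpl in Ht.
    assert (T : Rabs t <= X).
    { replace t with ((t + - x) + x) by ring.
      eapply Rle_trans; [apply Rabs_triang|]. lra. }
    assert (Eg : eta h t a = g (h, t, a)).
    { apply (Hg (h, t, a)). unfold box3; simpl. lra. }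
    rewrite Eg. apply f_equal. change ((h + (t - x) * 0, x + (t - x) * 1, a + (t - x) * 0)
      = (h, t, a)).
    apply f_equal2; [apply f_equal2|]; ring.
  - apply (is_derive_comp (fun t => g (plus z (scal t v))) (fun t => t - x)).
    + rewrite Rminus_diag. exact Hl.
    + auto_derive; [exact I | ring].
Qed.

Lemma Derive_bound_lipschitz f X K :
  (forall x, Rabs x < X -> ex_derive f x /\ Rabs (Derive f x) <= K) ->
  forall x y, Rabs x < X -> Rabs y < X -> Rabs (f x - f y) <= K * Rabs (x - y).
Proof.
  intros Hf x y Hx Hy.
  apply Rabs_lt_between in Hx. apply Rabs_lt_between in Hy.
  assert (In : forall t, Rmin y x <= t <= Rmax y x -> Rabs t < X).
  { intros t Ht. apply Rabs_lt_between.
    unfold Rmin, Rmax in Ht. destruct Rle_dec; lra. }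
  destruct (MVT_gen f y x (Derive f)) as [c [Hc E]].
  - intros t Ht. apply Derive_correct. apply Hf, In. lra.
  - intros t Ht. apply continuity_pt_filterlim.
    apply (ex_derive_continuous f). apply Hf, In, Ht.
  - rewrite E, Rabs_mult. apply Rmult_le_compat_r; [apply Rabs_pos|].
    apply Hf, In, Hc.
Qed.

Lemma admissible_small_parameters H X A K h0 eps0 alpha0 h a :
  admissible H X A K h0 eps0 alpha0 -> 0 < K -> 0 < h <= h0 -> Rabs a <= alpha0 ->
  small_parameters h a eps0 /\ K * eps0 <= 1 / 5.
Proof.
  intros ((Hh0 & _) & (He0 & _) & (Ha0 & _) & Hsq) HK Hh Ha.
  assert (M1 := Rmin_l (1 / 10) (8 * K ^ 2)).
  assert (M2 := Rmin_l (1 / 10) (1 / (5 * K))).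
  assert (M2' := Rmin_r (1 / 10) (1 / (5 * K))).
  assert (M3 := Rmin_l (1 / 288) (1 / (72 * K ^ 2))).
  apply Rabs_le_between in Ha.
  repeat split; try lra.
  - assert (X1 := sqrt_sqrt (2 * alpha0) ltac:(lra)).
    assert (X2 := sqrt_pos (2 * alpha0)). nra.
  - apply (Rle_trans _ (K * (1 / (5 * K)))).
    + apply Rmult_le_compat_l; lra.
    + right. field. lra.
Qed.

Lemma remainder_profile_of_pair k H X A K h0 eps0 alpha0 eta h a s :
  (1 <= k)%nat -> 0 < K -> Ck_on k (box3 H X A) (uncurry3 eta) ->
  eta_bound H X A K eta -> admissible H X A K h0 eps0 alpha0 ->
  0 < h <= h0 -> Rabs a <= alpha0 -> side s ->
  profile eps0 (remainder_profile s (fun x => eta h x a)).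
Proof.
  intros Hk HK HC Hb Had Hh Ha Hs.
  destruct (admissible_small_parameters _ _ _ _ _ _ _ h a Had HK Hh Ha)
    as [(_ & _ & He & _) HKe].
  destruct Had as ((_ & HhH) & (_ & HeX) & (_ & HaA) & _).
  apply (remainder_profile_spec eps0 K); auto.
  - intros x Hx. destruct (Hb h x a ltac:(lra) ltac:(lra) ltac:(lra)) as [B _].
    apply (B 0%nat). lia.
  - intros x y Hx Hy.
    apply (Derive_bound_lipschitz (fun x => eta h x a) X K); [|lra|lra].
    intros t Ht. split.
    + apply (Ck_on_box3_ex_derive k H X A); auto; lra.
    + destruct (Hb h t a ltac:(lra) ltac:(lra) ltac:(lra)) as [B _].
      apply (B 1%nat). lia.
Qed.

Lemma normal_forms_side_pair p k H X A K c h0 eps0 alpha0 etaPhi etaphi h a s :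
  (1 <= k)%nat -> normal_form_pair p k H X A K c etaPhi etaphi ->
  admissible H X A K h0 eps0 alpha0 ->
  0 < h <= h0 -> Rabs a <= alpha0 -> side s ->
  side_pair h a eps0 (c * h ^ p) s
    (remainder_profile s (fun x => etaPhi h x a))
    (remainder_profile s (fun x => etaphi h x a))
    (fun x => normal_form etaPhi h x a) (fun x => normal_form etaphi h x a).
Proof.
  intros Hk (_ & _ & _ & HK & Hc & CP & Cp & BP & Bp & HD) Had Hh Ha Hs.
  destruct (admissible_small_parameters _ _ _ _ _ _ _ h a Had HK Hh Ha) as [Hsm _].
  assert (PP := fun s => remainder_profile_of_pair k H X A K h0 eps0 alpha0
                  etaPhi h a s Hk HK CP BP Had Hh Ha).
  assert (Pp := fun s => remainder_profile_of_pair k H X A K h0 eps0 alpha0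
                  etaphi h a s Hk HK Cp Bp Had Hh Ha).
  assert (S1 : side 1) by (left; reflexivity).
  assert (S2 : side (-1)) by (right; reflexivity).
  assert (Inj : forall eta, (forall s, side s ->
      profile eps0 (remainder_profile s (fun x => eta h x a))) ->
    inj_on eps0 (fun x => normal_form eta h x a)).
  { intros eta HP.
    apply (inj_on_two_sides h a eps0 _ _ _ Hsm (HP 1 S1) (HP (-1) S2));
      apply normal_form_sided; assumption. }
  split; [assumption|]. split.
  { apply Rmult_le_pos; [lra|]. apply pow_le. lra. }
  split; [assumption|]. split; [auto|]. split; [auto|]. split.
  - intros t Ht.
    destruct Had as ((_ & HhH) & (_ & HeX) & (_ & HaA) & _).
    destruct (Req_dec t 0) as [->|T0].
    + destruct (PP s Hs) as [E1 _]. destruct (Pp s Hs) as [E2 _].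
      rewrite E1, E2, Rminus_diag, Rabs_R0. apply Req_le. ring.
    + assert (Bt : Rabs (s * t) <= X) by (rewrite Rabs_side by (auto; lra); lra).
      specialize (HD h (s * t) a ltac:(lra) Bt ltac:(lra)).
      assert (Ht' : 0 < h * t) by nra.
      apply (Rmult_le_reg_l (h * t)); [assumption|].
      (* Multiplied by h t, the difference of the profiles is that of the maps. *)
      rewrite <- (Rabs_pos_eq (h * t)) at 1 by lra.
      rewrite <- Rabs_mult.
      replace (h * t * (c * h ^ p * t ^ 3)) with (c * h ^ (p + 1) * (s * t) ^ 4)
        by (rewrite pow_add; destruct Hs as [-> | ->]; ring).
      eapply Rle_trans; [|exact HD]. right.
      rewrite <- (Rabs_Ropp (normal_form _ _ _ _ - _)).
      unfold normal_form, remainder_profile.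
      destruct Hs as [-> | ->].
      * f_equal. ring.
      * rewrite <- Rabs_Ropp. f_equal. ring.
  - repeat split; auto using normal_form_sided.
Qed.

Lemma conjugacy_estimate p k H X A K c h0 eps0 alpha0 etaPhi etaphi h x a :
  (1 <= k)%nat -> normal_form_pair p k H X A K c etaPhi etaphi ->
  admissible H X A K h0 eps0 alpha0 ->
  0 < h <= h0 -> Rabs x <= eps0 -> Rabs a <= alpha0 ->
  Rabs (x - conjugacy eps0 (normal_form etaPhi) (normal_form etaphi) h x a)
    <= c * h ^ p.
Proof.
  intros Hk HN Had Hh Hx Ha. unfold conjugacy.
  assert (SP := fun s => normal_forms_side_pair p k H X A K c h0 eps0 alpha0
                  etaPhi etaphi h a s Hk HN Had Hh Ha).
  apply Rabs_le_between in Hx.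
  destruct (Rtotal_order x 0) as [L|[->|L]].
  - replace x with (-1 * - x) by ring.
    apply (J_fiber_estimate h a eps0 _ (-1) _ _ _ _ (- x)
             (SP (-1) (or_intror eq_refl))). lra.
  - assert (J0 : forall F G, J_fiber eps0 F G a 0 = 0).
    { intros F G. unfold J_fiber. destruct Req_dec_T; [reflexivity | lra]. }
    rewrite J0, Rminus_diag, Rabs_R0.
    destruct (SP 1 (or_introl eq_refl)) as (_ & D0 & _). exact D0.
  - replace x with (1 * x) by ring.
    apply (J_fiber_estimate h a eps0 _ 1 _ _ _ _ x
             (SP 1 (or_introl eq_refl))). lra.
Qed.

(** * Optimality *)

(** The family is stable under directional derivatives: differentiating only
    changes the coefficient and lowers the exponent. *)
Lemma Ck_power (k n : nat) (b : R) :
  Ck k (fun _ : R * R * R => True) (fun z => b * fst (fst z) ^ n).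
Proof.
  revert n b. induction k as [|k IH]; intros n b.
  all: assert (C : forall z : R * R * R, True ->
    continuous (fun z : R * R * R => b * fst (fst z) ^ n) z).
  1, 3: intros z _;
    apply (continuous_comp (fun z : R * R * R => fst (fst z)) (fun x => b * x ^ n));
    [ apply (continuous_comp (fun z : R * R * R => fst z) (fun z : R * R => fst z));
      apply continuous_fst
    | apply (ex_derive_continuous (fun x => b * x ^ n)); auto_derive; exact I ].
  - split; [exact C | exact I].
  - split; [exact C|]. intro v.
    assert (D : forall z : R * R * R,
      is_derive (fun t : R => b * fst (fst (plus z (scal t v))) ^ n) 0
        (b * INR n * fst (fst v) * fst (fst z) ^ pred n)).
    { intros [[z1 z2] z3]. destruct v as [[v1 v2] v3].
      change (is_derive (fun t : R => b * (z1 + t * v1) ^ n) 0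
        (b * INR n * v1 * z1 ^ pred n)).
      auto_derive; [exact I|]. rewrite Rmult_0_l, Rplus_0_r. ring. }
    split.
    + intros z _. eexists. apply D.
    + refine (eq_ind _ (Ck k _) (IH (pred n) (b * INR n * fst (fst v))) _ _).
      apply functional_extensionality. intro z. symmetry.
      apply is_derive_unique, D.
Qed.

Lemma power_remainder_pair p k :
  normal_form_pair p k 1 1 1 1 1 (fun _ _ _ => 0) (fun h _ _ => h ^ p).
Proof.
  assert (C : forall b, Ck_on k (box3 1 1 1) (uncurry3 (fun h _ _ => b * h ^ p))).
  { intro b. exists (fun _ => True), (fun z => b * fst (fst z) ^ p).
    repeat split; [apply open_true | apply Ck_power]. }
  assert (B : forall g : R -> R, (forall h, 0 <= h <= 1 -> Rabs (g h) <= 1) ->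
            eta_bound 1 1 1 1 (fun h _ _ => g h)).
  { intros g Hg h x a Hh _ _. split.
    - intros [|i] _; [apply Hg, Hh|].
      rewrite (Derive_n_const i (g h)), Rabs_R0. lra.
    - rewrite Derive_const, Rabs_R0. lra. }
  do 5 (split; [lra|]). split; [|split; [|split; [|split]]].
  - (* Both remainders have the form b h^p. *)
    replace (fun _ _ _ : R => 0) with (fun h _ _ : R => 0 * h ^ p); [apply C|].
    do 3 (apply functional_extensionality; intro). ring.
  - replace (fun h _ _ : R => h ^ p) with (fun h _ _ : R => 1 * h ^ p); [apply C|].
    do 3 (apply functional_extensionality; intro). ring.
  - apply (B (fun _ => 0)). intros. rewrite Rabs_R0. lra.
  - apply (B (fun h => h ^ p)). intros h Hh.
    rewrite Rabs_pos_eq by (apply pow_le; lra).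
    rewrite <- (pow1 p). apply pow_incr. exact Hh.
  - intros h x a Hh _ _. right. unfold normal_form.
    rewrite <- Rabs_Ropp, <- (Rabs_pos_eq (1 * h ^ (p + 1) * x ^ 4)).
    + f_equal. rewrite pow_add. ring.
    + rewrite Rmult_1_l. apply Rmult_le_pos; [apply pow_le; lra | nra].
Qed.

(** The conjugacy maps the fixed point [w] of the discretization to the fixed
    point [w'] of the flow.  These satisfy w'^2 = a and w^2 - h^p w^3 = a, so
    (w - w') (w + w') = h^p w^3, which gives w - w' >= h^p w^2 / 2, while
    w^2 >= a. *)
Lemma power_remainder_gap p h0 eps0 alpha0 h a :
  admissible 1 1 1 1 h0 eps0 alpha0 -> 0 < h <= h0 -> 0 < a <= alpha0 ->
  exists x, Rabs x <= eps0 /\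
    a / 2 * h ^ p <=
    Rabs (x - conjugacy eps0 (normal_form (fun _ _ _ => 0))
                (normal_form (fun h _ _ => h ^ p)) h x a).
Proof.
  intros Had Hh Ha.
  assert (SP := normal_forms_side_pair p 1 1 1 1 1 1 h0 eps0 alpha0 _ _ h a 1
    (le_n 1) (power_remainder_pair p 1) Had Hh
    ltac:(rewrite Rabs_pos_eq; lra) (or_introl eq_refl)).
  assert (SP' := SP). destruct SP' as (Hs & _ & _ & Hq & Hr & _).
  destruct (half_map_fixed_point h a eps0 _ Hs Hq ltac:(lra)) as [w' [Hw' Ew']].
  destruct (half_map_fixed_point h a eps0 _ Hs Hr ltac:(lra)) as [w [Hw Ew]].
  exists (1 * w). split; [rewrite Rmult_1_l, Rabs_pos_eq; lra|].
  unfold conjugacy.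
  rewrite (J_fiber_fixed_point h a eps0 _ 1 _ _ _ _ w w' SP) by (assumption || lra).
  unfold remainder_profile in Ew, Ew'.
  assert (Hp : 0 < h ^ p) by (apply pow_lt; lra).
  set (m := h ^ p) in *. clearbody m.
  assert (E : (w - w') * (w + w') = m * w * w ^ 2) by lra.
  assert (G : a <= w ^ 2) by (assert (0 <= w ^ 3 * m) by (apply Rmult_le_pos; [apply pow_le|]; lra); lra).
  assert (W : w' <= w).
  { assert (0 <= m * w * w ^ 2) by (repeat apply Rmult_le_pos; nra). nra. }
  rewrite Rabs_pos_eq by lra.
  assert (P : m * w ^ 2 <= 2 * (w - w')).
  { apply (Rmult_le_reg_r w); [lra|]. nra. }
  nra.
Qed.

Theorem theorem2p16 (p k : nat) (hp : (1 <= p)%nat) (hk : (2 <= k)%nat) :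
  (forall (f : R -> R -> R) (Phi phi : R -> R -> R -> R),
     Ck (p + 7) (fun _ : R * R => True) (uncurry2 f) ->
     pitchfork f ->
     time_map f Phi ->
     Ck_small3 k phi ->
     order_p p Phi phi ->
     pitchfork_map phi ->
     forall (etaPhi etaphi : R -> R -> R -> R)
       (H X A K c h0 eps0 alpha0 : R),
     normal_form_pair p k H X A K c etaPhi etaphi ->
     normal_forms_of p k Phi phi (normal_form etaPhi) (normal_form etaphi) ->
     admissible H X A K h0 eps0 alpha0 ->
     exists const : R, 0 < const /\
       forall h x a : R,
         0 < h <= h0 -> Rabs x <= eps0 -> Rabs a <= alpha0 ->
         Rabs (x - conjugacy eps0 (normal_form etaPhi) (normal_form etaphi) h x a)
           <= const * h ^ p)
  /\
  (exists (etaPhi etaphi : R -> R -> R -> R) (H X A K c : R),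
     normal_form_pair p k H X A K c etaPhi etaphi /\
     forall h0 eps0 alpha0 : R,
       admissible H X A K h0 eps0 alpha0 ->
       exists alpha1 : R, 0 < alpha1 /\
         forall a : R, 0 < a <= alpha1 ->
         exists const : R, 0 < const /\
         exists h1 : R, 0 < h1 /\
           forall h : R, 0 < h <= h1 ->
           Rbar_le (Finite (const * h ^ p))
             (Lub_Rbar (fun r : R => exists x : R, Rabs x <= eps0 /\
                r = Rabs (x - conjugacy eps0 (normal_form etaPhi)
                                (normal_form etaphi) h x a)))).
Proof.
  split.
  - intros f Phi phi _ _ _ _ _ _ etaPhi etaphi H X A K c h0 eps0 alpha0 HN _ Had.
    exists c. split; [apply HN|]. intros h x a Hh Hx Ha.
    apply (conjugacy_estimate p k H X A K c h0 eps0 alpha0); auto. lia.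
  - exists (fun _ _ _ => 0), (fun h _ _ => h ^ p), 1, 1, 1, 1, 1.
    split; [apply power_remainder_pair|]. intros h0 eps0 alpha0 Had.
    assert (Pos : 0 < h0 /\ 0 < alpha0) by (destruct Had; lra).
    exists alpha0. split; [lra|]. intros a Ha.
    exists (a / 2). split; [lra|]. exists h0. split; [lra|]. intros h Hh.
    destruct (power_remainder_gap p h0 eps0 alpha0 h a Had Hh Ha) as [x [Hx Gx]].
    apply (Rbar_le_trans _ (Finite (Rabs (x - conjugacy eps0
      (normal_form (fun _ _ _ => 0)) (normal_form (fun h _ _ => h ^ p)) h x a)))).
    + exact Gx.
    + apply Lub_Rbar_correct. exists x. split; [exact Hx | reflexivity].
Qed.
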